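(* Let $G=(X,E)$ be a graph on $d$ vertices. Then (i) $\Delta(\mathrm{ap}(\mathcal{S}_G)) = \mathcal{D}_X\cap\mathrm{ap}(\mathcal{S}_G) = \mathrm{vp}(G)$; (ii) $\Delta(\mathrm{cp}(\mathcal{S}_G)) = \mathcal{D}_X\cap\mathrm{cp}(\mathcal{S}_G) = \mathrm{vp}(G^c)$; (iii) $\Delta(\mathrm{fp}(\mathcal{S}_G)) = \mathcal{D}_X\cap\mathrm{fp}(\mathcal{S}_G) = \mathrm{vp}(G^c)$.
   Context: Graphs are finite, undirected and without loops; $G^c$ is the graph complement. Write $x\sim y$ if $\{x,y\}\in E$ and $x\simeq y$ if $x\sim y$ or $x=y$. Identify $X$ with $\{1,\dots,d\}$, let $(e_x)_{x\in X}$ be the canonical orthonormal basis of $H=\mathbb{C}^d$, and set $\mathcal{S}_G=\mathrm{span}\{e_xe_y^* : x\simeq y\}\subseteq M_d=\mathcal{L}(H)$, where $\xi\eta^*$ is the operator $\zeta\mapsto\langle\zeta,\eta\rangle\xi$ (inner products linear in the first variable). $\mathcal{D}_X$ is the algebra of diagonal matrices with respect to $(e_x)_{x\in X}$ and $\Delta:M_d\to\mathcal{D}_X$ is the conditional expectation (deleting the off-diagonal entries). Vectors in $\mathbb{R}^d$ are identified with the corresponding diagonal matrices. A set $S\subseteq X$ is independent if no two distinct elements are adjacent. The vertex packing polytope of $G$ is $\mathrm{vp}(G)=\mathrm{conv}\{\chi_S : S\subseteq X \text{ independent}\}$, where $\chi_S$ is the characteristic function of $S$. An operator system in $\mathcal{L}(H)$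 is a linear subspace $\mathcal{S}$ containing $I$ and closed under adjoints. ''Projection'' means orthogonal projection. An $\mathcal{S}$-clique is a set $\{\xi_i\}_{i=1}^m$ of mutually orthogonal unit vectors in $H$ with $\xi_i\xi_j^*\in\mathcal{S}$ whenever $i\ne j$. A projection $P$ is $\mathcal{S}$-abelian if $P\mathcal{S}P$ is contained in an abelian C*-subalgebra of $\mathcal{L}(H)$; $\mathcal{S}$-clique if its range is the span of an $\mathcal{S}$-clique; $\mathcal{S}$-full if $\mathcal{L}(PH)\oplus 0_{P^\perp}\subseteq\mathcal{S}$. For $\mathcal{C}\subseteq\mathcal{L}(H)$, $\mathrm{her}(\mathcal{C})=\{A\in\mathcal{L}(H)^+ : \exists B\in\mathcal{C},\ A\le B\}$. The sets $\mathrm{ap}(\mathcal{S})$, $\mathrm{cp}(\mathcal{S})$, $\mathrm{fp}(\mathcal{S})$ are $\mathrm{her}(\overline{\mathrm{conv}}(\mathcal{P}))$ where $\mathcal{P}$ is the set of all $\mathcal{S}$-abelian, respectively $\mathcal{S}$-clique, respectively $\mathcal{S}$-full projections. *)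

(* Defs.v *)
From HB Require Import structures.
From mathcomp Require Import all_boot all_order all_algebra.
From mathcomp Require Import complex.
From mathcomp Require Import boolp classical_sets reals topology normedtype convex.

Set Implicit Arguments.
Unset Strict Implicit.
Unset Printing Implicit Defensive.

Import Order.TTheory GRing.Theory Num.Theory.
Import numFieldNormedType.Exports.
Local Open Scope classical_set_scope.
Local Open Scope ring_scope.
Local Open Scope complex_scope.
Local Open Scope sesquilinear_scope.

(* The libraries put no topology on R[i]; this is the one given by the modulus.
   Matrices over R[i] then carry the entrywise (hence norm) topology. *)
HB.instance Definition _ (R : rcfType) :=
  PseudoPointedMetric.copy R[i] (R[i]^o).

Definition conv_hull (K : numDomainType) (V : lmodType K) (A : set V) : set V :=
  smallest (@convex_set K V) A.

Section Operators.
Variables (R : realType) (d : nat).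
Local Notation C := R[i].
Local Notation H := 'cV[C]_d.
Local Notation LH := 'M[C]_d.

Definition inner (xi eta : H) : C := (eta^t* *m xi) 0 0.

Definition ketbra (xi eta : H) : LH := xi *m eta^t*.

(* On C, [0 <= z] means that z is real and nonnegative. *)
Definition psd (A : LH) : Prop := forall xi : H, 0 <= inner (A *m xi) xi.

Definition projection (P : LH) : Prop := P *m P = P /\ P^t* = P.

Definition ran (P : LH) : {vspace H} :=
  limg (linfun (mulmx P : H -> H)).

Definition operator_system (S : {vspace LH}) : Prop :=
  1%:M \in S /\ (forall A, A \in S -> A^t* \in S).

Definition cstar_subalgebra (A : set LH) : Prop :=
  [/\ A 0,
      forall (a : C) (x y : LH), A x -> A y -> A (a *: x + y),
      forall x y : LH, A x -> A y -> A (x *m y),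
      forall x : LH, A x -> A (x^t*)
    & closed A].

Definition abelian_set (A : set LH) : Prop :=
  forall x y : LH, A x -> A y -> x *m y = y *m x.

Definition abelian_proj (S : {vspace LH}) (P : LH) : Prop :=
  projection P /\
  exists A : set LH, [/\ cstar_subalgebra A, abelian_set A
                       & forall T : LH, T \in S -> A (P *m T *m P)].

Definition clique (S : {vspace LH}) (m : nat) (xi : 'I_m -> H) : Prop :=
  (forall i j, inner (xi i) (xi j) = (i == j)%:R) /\
  (forall i j, i != j -> ketbra (xi i) (xi j) \in S).

Definition clique_proj (S : {vspace LH}) (P : LH) : Prop :=
  projection P /\
  exists (m : nat) (xi : 'I_m -> H), clique S xi /\ ran P = <<codom xi>>%VS.

(* The elements of L(PH) (+) 0: A maps PH into itself and kills its orthogonal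
   complement. *)
Definition corner (P : LH) : set LH :=
  [set A | (forall v, v \in ran P -> A *m v \in ran P) /\
           (forall v, (forall w, w \in ran P -> inner v w = 0) -> A *m v = 0)].

Definition full_proj (S : {vspace LH}) (P : LH) : Prop :=
  projection P /\ forall A : LH, corner P A -> A \in S.

Definition her (B : set LH) : set LH :=
  [set A | psd A /\ exists2 D, B D & psd (D - A)].

Definition ap (S : {vspace LH}) : set LH :=
  her (closure (conv_hull (abelian_proj S))).
Definition cp (S : {vspace LH}) : set LH :=
  her (closure (conv_hull (clique_proj S))).
Definition fp (S : {vspace LH}) : set LH :=
  her (closure (conv_hull (full_proj S))).

Definition diagonals : set LH := [set A | is_diag_mx A].

Definition Delta (A : LH) : LH := diag_mx (\row_x A x x).

Definition diag_of_real (v : 'rV[R]_d) : LH := diag_mx (map_mx (real_complex R) v).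

End Operators.

Arguments diagonals R d : clear implicits.

Definition basis_vec (R : realType) (d : nat) (x : 'I_d) : 'cV[R[i]]_d :=
  delta_mx x 0.

Definition graph_opsys (R : realType) (d : nat) (adj : rel 'I_d) :
    {vspace 'M[R[i]]_d} :=
  <<[seq ketbra (basis_vec R p.1) (basis_vec R p.2) |
      p in [pred p : 'I_d * 'I_d | (p.1 == p.2) || adj p.1 p.2]]>>%VS.

Definition graph_compl (d : nat) (adj : rel 'I_d) : rel 'I_d :=
  [rel x y | (x != y) && ~~ adj x y].

Definition independent (d : nat) (adj : rel 'I_d) (S : {set 'I_d}) : Prop :=
  {in S &, forall x y, x != y -> ~~ adj x y}.

Definition char_vec (R : realType) (d : nat) (S : {set 'I_d}) : 'rV[R]_d :=
  \row_x (x \in S)%:R.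

Definition vp (R : realType) (d : nat) (adj : rel 'I_d) : set 'rV[R]_d :=
  conv_hull [set char_vec R S | S in independent adj].

Arguments vp R {d} adj.

Lemma graph_opsysP (R : realType) (d : nat) (adj : rel 'I_d) :
  symmetric adj -> operator_system (graph_opsys R adj).
Proof.
move=> sadj; rewrite /graph_opsys; set s := image_mem _ _.
have eE x y : ketbra (basis_vec R x) (basis_vec R y) = delta_mx x y.
  rewrite /ketbra; have -> : (basis_vec R y)^t* = delta_mx 0 y.
    by apply/matrixP=> i j; rewrite !mxE andbC; case: andP; rewrite ?rmorph1 ?rmorph0.
  by rewrite mul_delta_mx.
have sP x y : (x == y) || adj x y -> delta_mx x y \in graph_opsys R adj.
  move=> xy; rewrite -eE; apply: memv_span; rewrite /s; apply/mapP; exists (x, y) => //.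
  by rewrite mem_enum inE.
split.
  have -> : 1%:M = \sum_x delta_mx x x :> 'M[R[i]]_d.
    apply/matrixP=> i j; rewrite summxE (bigD1 i) //= !mxE eqxx eq_sym big1 ?addr0 //.
    by move=> k /negbTE ki; rewrite !mxE eq_sym ki.
  by apply: memv_suml => x _; apply: sP; rewrite eqxx.
move=> A /(@coord_span _ _ _ (in_tuple s)) ->.
rewrite !raddf_sum /=; apply: memv_suml => i _.
rewrite linearZ /= map_mxZ /=; apply: memvZ.
have /mapP [[x y]] : s`_i \in s by rewrite mem_nth.
rewrite mem_enum inE /= => xy ->; rewrite eE trmx_delta.
have -> : map_mx Num.conj (delta_mx y x) = delta_mx y x :> 'M[R[i]]_d.
  by apply/matrixP=> a b; rewrite !mxE; case: andP; rewrite ?rmorph1 ?rmorph0.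
by apply: sP; rewrite eq_sym sadj.
Qed.

(* Main.v *)
Require Import Defs.
From mathcomp Require Import all_boot all_order all_algebra.
From mathcomp Require Import boolp classical_sets reals.
From mathcomp Require Import complex interval_inference.
From mathcomp Require Import topology normedtype convex.

(** All three identities say that the diagonals of a convex corner of operators
    form the vertex packing polytope of a graph. One inclusion holds because the
    vertices of the polytope are the diagonals of coordinate projections, which
    are themselves abelian, clique or full projections ([abelian_char_vec],
    [clique_char_vec], [full_char_vec]). For the other one, passing from the
    projections to their hereditary closed convex cover is harmless: the polytope
    is convex, closed ([vp_closed]) and hereditary ([vp_hereditary]), and taking
    the diagonal is linear, continuous and monotone. So everything reduces, in
    [diagonal_corners], to showing that the diagonal [v x = P x x = |P e_x|^2] of
    each projection [P] of the given type lies in the polytope.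

    The common criterion is [vp_classes]. Suppose that the vertices are sorted
    into classes, each of total [v]-mass at most 1, and that adjacent vertices of
    the support of [v] always belong to the same class. Choosing at random,
    independently in every class, at most one vertex, with [x] having probability
    [v x], gives a random independent set with marginals [v].

    For an abelian projection the nonzero vectors [P e_x] are pairwise orthogonal
    or parallel, and parallel when [x] and [y] are adjacent; the classes are those
    of parallel vectors ([rdiag_abelian]). For the projection onto the span of a
    clique [xi], two non-adjacent vertices can only meet the support of one and
    the same [xi i]; the classes are the vertices that lie in the support of
    [xi i] only, and single vertices otherwise ([rdiag_clique]). For a full
    projection the support of the diagonal is a clique of the graph, and the
    classes are single vertices ([rdiag_full]). *)

Set Implicit Arguments.
Unset Strict Implicit.
Unset Printing Implicit Defensive.

Import Order.TTheory GRing.Theory Num.Theory.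
Import numFieldNormedType.Exports.
Local Open Scope classical_set_scope.
Local Open Scope ring_scope.
Local Open Scope complex_scope.
Local Open Scope sesquilinear_scope.

(** * Convex hulls of finitely many points *)

Section ConvexHulls.
Variable K : numDomainType.

Lemma convex_setP (V : lmodType K) (A : set V) :
  @convex_set K V A <-> forall x y t, 0 <= t <= 1 -> A x -> A y ->
    A (t *: x + (1 - t) *: y).
Proof.
split=> [cA x y t /andP[t0 t1] Ax Ay|cA x y t /set_mem Ax /set_mem Ay].
  pose u : {i01 K} := Itv01 t0 t1.
  by have /set_mem := cA x y u (mem_set Ax) (mem_set Ay).
apply/mem_set; apply: cA => //; apply/andP; split; [exact: ge0|exact: le1].
Qed.

Lemma sub_conv_hull (V : lmodType K) (A : set V) : A `<=` conv_hull A.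
Proof. exact: sub_gen_smallest. Qed.

Lemma conv_hull_min (V : lmodType K) (A B : set V) :
  @convex_set K V B -> A `<=` B -> conv_hull A `<=` B.
Proof. exact: smallest_sub. Qed.

Lemma conv_hull_convex (V : lmodType K) (A : set V) :
  @convex_set K V (conv_hull A).
Proof.
apply/convex_setP => x y t t01 Ax Ay B [cB AB].
by apply: (convex_setP B).1 => //; [exact: Ax|exact: Ay].
Qed.

End ConvexHulls.

(** Convexity is given for two points at a time, so the barycentre is built up
    one point after the other; the induction needs arbitrary total mass, hence
    the normalised statement proved on the way. *)
Lemma convex_sum (K : numFieldType) (V : lmodType K) (A : set V) (I : eqType)
    (r : seq I) (w : I -> K) (a : I -> V) :
  @convex_set K V A -> (forall i, 0 <= w i) -> (forall i, A (a i)) ->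
  \sum_(i <- r) w i = 1 -> A (\sum_(i <- r) w i *: a i).
Proof.
move=> /convex_setP cA w0 Aa; set s := \sum_(i <- r) w i => s1.
suff h : s != 0 -> A (s^-1 *: \sum_(i <- r) w i *: a i).
  by have := h; rewrite s1 invr1 scale1r oner_neq0; apply.
rewrite {s1}/s; elim: r => [|i r IHr]; rewrite ?big_nil ?eqxx// !big_cons.
have s0 : 0 <= \sum_(j <- r) w j by exact: sumr_ge0.
set s := \sum_(j <- r) w j in IHr s0 *; set b := \sum_(j <- r) w j *: _ in IHr *.
have [sE ws|sN0 ws] := eqVneq s 0.
  have -> : b = 0.
    rewrite /b big_seq big1 // => j jr.
    have /eqP := sE; rewrite psumr_eq0 => [/allP /(_ _ jr) /eqP ->|//].
    by rewrite scale0r.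
  by move: ws; rewrite sE !addr0 => ws; rewrite scalerA mulVf// scale1r; exact: Aa.
have p : 0 < w i + s by rewrite ltr_wpDl// lt_neqAle eq_sym sN0.
have -> : (w i + s)^-1 *: (w i *: a i + b) =
    (w i / (w i + s)) *: a i + (1 - w i / (w i + s)) *: (s^-1 *: b).
  rewrite scalerDr !scalerA mulrC; congr (_ + _ *: _).
  rewrite -[X in X - _](divff ws) -mulrBl [w i + s]addrC addrK.
  by rewrite mulrAC divff// mul1r.
apply: cA => //; last exact: IHr.
by rewrite divr_ge0 ?w0 ?(ltW p)// ler_pdivrMr// mul1r lerDl.
Qed.

Lemma continuous_mx (T : topologicalType) (K : topologicalType) m n
    (f : T -> 'M[K]_(m, n)) :
  (forall i j, continuous (fun x => f x i j)) -> continuous f.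
Proof.
move=> cf x B [P nP sPB]; apply: (@filterS _ (nbhs x) _
  [set y | forall i, (forall j, P i j (f y i j))]).
  by move=> y /sPB.
apply: filter_forall => i; apply: filter_forall => j.
exact: (cf i j x _ (nP i j)).
Qed.

Section Polytopes.
Variable R : realType.

Definition simplex (n : nat) : set 'rV[R]_n :=
  [set w | (forall i, 0 <= w 0 i) /\ \sum_i w 0 i = 1].

Lemma simplex_compact (n : nat) : compact (@simplex n).
Proof.
have -> : @simplex n = [set w : 'rV[R]_n | forall i, `[0, 1]%classic (w ord0 i)] `&`
    (fun w : 'rV[R]_n => \sum_i w 0 i) @^-1` [set 1].
  apply/seteqP; split=> w /= [w0 w1]; split=> // i; rewrite ?in_itv/=.
    by rewrite w0 -w1 (bigD1 i)//= lerDl sumr_ge0.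
  by have := w0 i; rewrite in_itv => /andP[].
apply: compact_closedI.
  by apply: (@rV_compact R n (fun=> `[0, 1]%classic)) => i; exact: segment_compact.
apply: preimage_closed; last exact: closed_eq.
move=> w _; apply: continuous_big.
  by move=> [a b]; exact: add_continuous.
move=> i _; exact: coord_continuous.
Qed.

Lemma conv_hull_rows n d (M : 'M[R]_(n, d)) :
  conv_hull (range (fun i => row i M)) = (fun w => w *m M) @` @simplex n.
Proof.
apply/seteqP; split.
  apply: conv_hull_min; last first.
    move=> _ [i _ <-]; exists (delta_mx 0 i); last by rewrite rowE.
    split=> [j|]; first by rewrite mxE eqxx ler0n.
    rewrite (bigD1 i)//= big1 ?addr0 ?mxE ?eqxx// => j /negbTE ji.
    by rewrite mxE ji.
  apply/convex_setP => _ _ t /andP[t0 t1] [w [w0 w1] <-] [v [v0 v1] <-].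
  exists (t *: w + (1 - t) *: v); last by rewrite mulmxDl !scalemxAl.
  split=> [i|].
    by rewrite !mxE addr_ge0// mulr_ge0 ?subr_ge0.
  under eq_bigr do rewrite !mxE.
  by rewrite big_split/= -!mulr_sumr w1 v1 !mulr1 addrC subrK.
move=> _ [w [w0 w1] <-]; rewrite mulmx_sum_row; apply: convex_sum => //.
  exact: conv_hull_convex.
by move=> i; apply: sub_conv_hull; exists i.
Qed.

(** The hull of finitely many points is the image of a compact simplex under a
    continuous map. *)
Lemma conv_hull_rows_closed n d (M : 'M[R]_(n, d)) :
  closed (conv_hull (range (fun i => row i M))).
Proof.
rewrite conv_hull_rows; apply: compact_closed; first exact: norm_hausdorff.
apply: continuous_compact (@simplex_compact n).
apply: continuous_subspaceT; apply: continuous_mx => i j.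
rewrite (_ : (fun _ => _) = fun w : 'rV_n => \sum_k w i k * M k j); last first.
  by apply/funext => w; rewrite mxE.
apply: continuous_big => [[a b]|k _ w]; first exact: add_continuous.
by apply: (@cvgM _ _ (nbhs w)); [exact: coord_continuous|exact: cvg_cst].
Qed.

End Polytopes.

(** * The vertex packing polytope *)

Section VertexPacking.
Variables (R : realType) (d : nat) (adj : rel 'I_d).

(** The independent sets are listed as the rows of a matrix indexed by all
    vertex sets, a set that is not independent being replaced by the empty one. *)
Lemma vp_closed : closed (vp R adj).
Proof.
pose M := \matrix_(i < #|{set 'I_d}|)
  char_vec R (if `[< independent adj (enum_val i) >]
    then enum_val i else finset.set0).
suff -> : vp R adj = conv_hull (range (fun i => row i M)).
  exact: conv_hull_rows_closed.
congr conv_hull; apply/seteqP; split.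
  move=> _ [S indS <-]; exists (enum_rank S) => //.
  by rewrite rowK enum_rankK asboolT.
move=> _ [i _ <-]; rewrite rowK.
have [indS|_] := asboolP (independent adj (enum_val i)).
  by exists (enum_val i).
by exists finset.set0 => // x y; rewrite inE.
Qed.

(** Such a [v] is the vector of marginals of a random independent set: in each
    class choose, independently of the other classes, at most one vertex, the
    vertex [x] with probability [v x]. Two adjacent vertices that can both occur
    lie in the same class, so they are never chosen together. *)
Lemma vp_classes (T : finType) (cls : 'I_d -> T) (v : 'rV[R]_d) :
  (forall x, 0 <= v 0 x) ->
  (forall c, \sum_(x | cls x == c) v 0 x <= 1) ->
  (forall x y, x != y -> adj x y -> v 0 x != 0 -> v 0 y != 0 ->
     cls x = cls y) ->
  vp R adj v.
Proof.
move=> v0 v1 vadj.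
(* the choice made in class c: ord0 stands for no vertex at all, and
   lift ord0 x for the vertex x *)
pose p c (o : 'I_d.+1) : R := if unlift ord0 o is Some x
  then if cls x == c then v 0 x else 0 else 1 - \sum_(x | cls x == c) v 0 x.
have p0 c o : 0 <= p c o.
  by rewrite /p; case: unliftP => [x _|_]; [case: ifP|rewrite subr_ge0].
have p1 c : \sum_o p c o = 1.
  rewrite big_ord_recl /p unlift_none.
  under [X in _ + X]eq_bigr do rewrite liftK.
  by rewrite -big_mkcond subrK.
pose sel (g : {ffun T -> 'I_d.+1}) :=
  [set x | (v 0 x != 0) && (g (cls x) == lift ord0 x)]%SET.
have -> : v = \sum_(g : {ffun T -> 'I_d.+1})
    (\prod_c p c (g c)) *: char_vec R (sel g).
  apply/rowP => x; rewrite summxE.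
  under eq_bigr => g _ do rewrite !mxE inE.
  have [vx0|vx0] := eqVneq (v 0 x) 0; first by rewrite big1// => g _; rewrite mulr0.
  (* the probability that x is chosen is again a sum over g of products over c,
     the event being a condition on the coordinate g (cls x) alone *)
  pose q c (o : 'I_d.+1) := p c o *
    (if c == cls x then (o == lift ord0 x)%:R else 1).
  transitivity (\sum_(g : {ffun T -> 'I_d.+1}) \prod_c q c (g c)).
    rewrite -bigA_distr_bigA (bigD1 (cls x))//= [X in _ * X]big1 ?mulr1.
      rewrite (bigD1 (lift ord0 x))//= big1 ?addr0.
        by rewrite /q /p liftK !eqxx mulr1.
      by move=> o /negbTE ox; rewrite /q eqxx ox mulr0.
    move=> c /negbTE cx; rewrite -[RHS](p1 c); apply: eq_bigr => o _.
    by rewrite /q cx mulr1.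
  apply: eq_bigr => g _; rewrite /q big_split/=; congr (_ * _).
  by rewrite -big_mkcond/= big_pred1_eq.
apply: convex_sum; first exact: conv_hull_convex.
- by move=> g; exact: prodr_ge0.
- move=> g; apply: sub_conv_hull; exists (sel g) => // x y.
  rewrite !inE => /andP[vx /eqP gx] /andP[vy /eqP gy] xy.
  apply/negP => axy; have cxy := vadj _ _ xy axy vx vy.
  by case/eqP: xy; apply: (@lift_inj _ ord0); rewrite -gx -gy cxy.
- by rewrite -bigA_distr_bigA big1.
Qed.

Lemma vp_ge0 v : vp R adj v -> forall x, 0 <= v 0 x.
Proof.
suff H : vp R adj `<=` [set v | forall x, 0 <= v 0 x] by move=> /H.
apply: conv_hull_min.
  apply/convex_setP => u w t /andP[t0 t1] u0 w0 x.
  by rewrite !mxE addr_ge0// mulr_ge0// subr_ge0.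
by move=> _ [S _ <-] x; rewrite mxE ler0n.
Qed.

(** Below a characteristic vector this is [vp_classes] for one-vertex classes,
    and the vectors with all their minorants in the polytope form a convex set. *)
Lemma vp_hereditary (v w : 'rV[R]_d) :
  vp R adj w -> (forall x, 0 <= v 0 x <= w 0 x) -> vp R adj v.
Proof.
suff H : vp R adj `<=` [set w : 'rV_d | (forall x, 0 <= w 0 x) /\
    forall v : 'rV_d, (forall x, 0 <= v 0 x <= w 0 x) -> vp R adj v].
  by move=> /H [_]; apply.
move=> {v w}; apply: conv_hull_min; last first.
  move=> _ [S indS <-]; split=> [x|v vS]; first by rewrite mxE ler0n.
  have vNS x : v 0 x != 0 -> x \in S.
    have := vS x; rewrite mxE; case: (x \in S) => //=.
    by rewrite -eq_le eq_sym => ->.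
  apply: (@vp_classes _ id).
  - by move=> x; case/andP: (vS x).
  - move=> x; rewrite big_pred1_eq; case/andP: (vS x) => _ /le_trans; apply.
    by rewrite mxE lern1 leq_b1.
  - by move=> x y xy axy /vNS xS /vNS yS; have := indS _ _ xS yS xy; rewrite axy.
apply/convex_setP => w1 w2 t t01 [w10 H1] [w20 H2].
have /andP[t0 t1] := t01.
set w := t *: w1 + (1 - t) *: w2.
have wE x : w 0 x = t * w1 0 x + (1 - t) * w2 0 x by rewrite !mxE.
split=> [x|v vle]; first by rewrite wE addr_ge0// mulr_ge0// subr_ge0.
(* share out each coordinate of v in the ratio of those of w1 and w2 *)
pose u (w' : 'rV[R]_d) := \row_x (v 0 x / w 0 x * w' 0 x).
have r01 x : 0 <= v 0 x / w 0 x <= 1.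
  case/andP: (vle x) => v0 vw; have w0 := le_trans v0 vw.
  rewrite divr_ge0//=; have [->|wN0] := eqVneq (w 0 x) 0.
    by rewrite invr0 mulr0 ler01.
  by rewrite ler_pdivrMr ?mul1r// lt_neqAle eq_sym wN0.
have ule (w' : 'rV[R]_d) : (forall x, 0 <= w' 0 x) ->
    forall x, 0 <= u w' 0 x <= w' 0 x.
  move=> w'0 x; have /andP[r0 r1] := r01 x.
  by rewrite mxE mulr_ge0//= ler_piMl.
have -> : v = t *: u w1 + (1 - t) *: u w2.
  apply/rowP => x; rewrite !mxE; have := vle x.
  rewrite mulrCA [X in _ + X]mulrCA -mulrDr -wE.
  have [->|w0 _] := eqVneq (w 0 x) 0; last by rewrite divfK.
  by rewrite -eq_le => /eqP <-; rewrite mulr0.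
apply: (convex_setP (vp R adj)).1 => //; first exact: conv_hull_convex.
- by apply: H1; exact: ule.
- by apply: H2; exact: ule.
Qed.

End VertexPacking.

(** * Diagonals of hereditary convex covers *)

Section RealDiagonal.
Variables (R : realType) (d : nat).
Local Notation C := R[i].
Implicit Types (A P : 'M[C]_d).

Definition rdiag A : 'rV[R]_d := \row_x complex.Re (A x x).

Lemma rdiag_linear (t : R) A B :
  rdiag (t%:C *: A + B) = t *: rdiag A + rdiag B.
Proof.
by apply/rowP => x; rewrite !mxE; case: (A x x) (B x x) => [a b] [a' b']; simpc.
Qed.

Lemma diag_of_real_linear (t : R) (v w : 'rV[R]_d) :
  diag_of_real (t *: v + w) = t%:C *: diag_of_real v + diag_of_real w.
Proof.
apply/matrixP => x y; rewrite !mxE rmorphD rmorphM.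
by case: eqP => _; rewrite ?mulr1n // !mulr0n mulr0 addr0.
Qed.

Lemma unit_interval_real (t : C) : 0 <= t <= 1 ->
  exists2 r : R, t = r%:C & 0 <= r <= 1.
Proof.
case/andP=> t0 t1; have tE := RRe_real (ger0_real t0).
by exists (complex.Re t); rewrite // -lecR -[X in _ && X]lecR tE t0.
Qed.

(** The real part is 1-Lipschitz for the modulus. *)
Lemma rdiag_continuous : continuous rdiag.
Proof.
apply: continuous_mx => i x.
rewrite (_ : (fun _ => _) = fun A : 'M[C]_d => complex.Re (A x x)); last first.
  by apply/funext => A; rewrite mxE.
move=> A B /(nbhs_ballP (complex.Re (A x x))) [e /= e0 eB].
apply/nbhs_ballP; exists e%:C => /=; first by rewrite ltcR.
move=> M [_ /(_ x x) AM]; apply: eB.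
have {}AM : `|A x x - M x x| < e%:C := AM.
suff : `|complex.Re (A x x) - complex.Re (M x x)| < e by [].
rewrite -ltcR; apply: le_lt_trans AM.
by rewrite -raddfB; exact: normc_ge_Re.
Qed.

Lemma basis_vec_adj (x : 'I_d) : (basis_vec R x)^t* = delta_mx 0 x.
Proof.
by apply/matrixP=> i j; rewrite !mxE andbC; case: andP; rewrite ?rmorph1 ?rmorph0.
Qed.

Lemma mx_diag_inner A (x : 'I_d) :
  inner (A *m basis_vec R x) (basis_vec R x) = A x x.
Proof. by rewrite /inner basis_vec_adj -rowE -colE !mxE. Qed.

Lemma psd_diag_ge0 A (x : 'I_d) : psd A -> 0 <= A x x.
Proof. by move=> psdA; rewrite -mx_diag_inner. Qed.

Lemma psd_diag_of_real (v : 'rV[R]_d) :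
  (forall x, 0 <= v 0 x) -> psd (diag_of_real v).
Proof.
move=> v0 xi; rewrite /inner mxE sumr_ge0// => x _.
rewrite /diag_of_real mul_diag_mx !mxE mulrCA mulr_ge0//.
  by rewrite ler0c.
by rewrite mulrC mul_conjC_ge0.
Qed.

Lemma Delta_psd A : psd A -> Delta A = diag_of_real (rdiag A).
Proof.
move=> psdA; congr diag_mx; apply/rowP => x; rewrite !mxE.
by rewrite RRe_real// ger0_real// psd_diag_ge0.
Qed.

Lemma Delta_diagonal A : diagonals R d A -> Delta A = A.
Proof.
move=> /is_diag_mxP dA; apply/matrixP => x y; rewrite !mxE.
by have [<-|xy] := eqVneq x y; rewrite ?mulr1n// mulr0n dA.
Qed.

Section Sandwich.
Variables (adj : rel 'I_d) (PP : set 'M[C]_d).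

(** The polytope absorbs each of the three operations that build the hereditary
    cover from its projections: it is convex, closed and hereditary, while the
    diagonal is linear, continuous and monotone. *)
Lemma rdiag_her :
  (forall P, PP P -> vp R adj (rdiag P)) ->
  forall A, her (closure (conv_hull PP)) A -> vp R adj (rdiag A).
Proof.
move=> PPvp A [psdA [D clD psdDA]].
have vpD : vp R adj (rdiag D).
  apply: vp_closed => B /rdiag_continuous /clD [M [PPM BM]].
  exists (rdiag M); split=> //; move: PPM; rewrite /=.
  suff H : conv_hull PP `<=` [set M | vp R adj (rdiag M)] by move/H.
  apply: conv_hull_min => //.
  apply/convex_setP => M1 M2 t /unit_interval_real [r -> r01] v1 v2 /=.
  rewrite rdiag_linear -[_ *: M2]addr0.
  have -> : 1 - r%:C = (1 - r)%:C by rewrite rmorphB rmorph1.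
  rewrite rdiag_linear (_ : rdiag 0 = 0) ?addr0; last first.
    by apply/rowP => x; rewrite !mxE.
  by apply: (convex_setP (vp R adj)).1 => //; exact: conv_hull_convex.
apply: vp_hereditary vpD _ => x; rewrite !mxE.
have := psd_diag_ge0 x psdA; have := psd_diag_ge0 x psdDA.
rewrite !mxE subr_ge0 !lecE => /andP[_ ->] /andP[_ ->] //.
Qed.

Lemma diag_of_real_her :
  (forall S, independent adj S -> PP (diag_of_real (char_vec R S))) ->
  forall v, vp R adj v -> her (closure (conv_hull PP)) (diag_of_real v).
Proof.
move=> PPS v vpv; split; first exact/psd_diag_of_real/(vp_ge0 vpv).
exists (diag_of_real v); last first.
  by rewrite subrr => xi; rewrite /inner mul0mx mulmx0 mxE.
apply: subset_closure; move: v vpv => {}v.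
suff H : vp R adj `<=` [set v | conv_hull PP (diag_of_real v)] by move/H.
apply: conv_hull_min; last by move=> _ [S /PPS ? <-]; exact: sub_conv_hull.
apply/convex_setP => v1 v2 r r01 H1 H2 /=.
rewrite diag_of_real_linear -[(1 - r) *: v2]addr0 diag_of_real_linear.
rewrite (_ : diag_of_real 0 = 0) ?addr0; last first.
  by apply/matrixP => x y; rewrite !mxE mul0rn.
rewrite rmorphB rmorph1; apply: (convex_setP (conv_hull PP)).1 => //.
  exact: conv_hull_convex.
by rewrite ler0c -[X in _ && X]lecR in r01 *.
Qed.

(** Reduces an identity about corners to the projections: the real diagonals of
    those in [PP] must lie in the polytope, whose vertices must themselves come
    from [PP]. The three sets are compared around a cycle of inclusions. *)
Lemma diagonal_corners :
  (forall P, PP P -> vp R adj (rdiag P)) ->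
  (forall S, independent adj S -> PP (diag_of_real (char_vec R S))) ->
  let Q := her (closure (conv_hull PP)) in
  @Delta R d @` Q = diagonals R d `&` Q /\
  diagonals R d `&` Q = @diag_of_real R d @` vp R adj.
Proof.
move=> up lo Q.
have sub1 : @Delta R d @` Q `<=` @diag_of_real R d @` vp R adj.
  move=> _ [A QA <-]; exists (rdiag A); first exact: rdiag_her QA.
  by rewrite Delta_psd//; case: QA.
have sub2 : @diag_of_real R d @` vp R adj `<=` diagonals R d `&` Q.
  move=> _ [v vpv <-]; split; last exact: diag_of_real_her.
  exact: diag_mx_is_diag.
have sub3 : diagonals R d `&` Q `<=` @Delta R d @` Q.
  by move=> A [dA QA]; exists A => //; exact: Delta_diagonal.
split; apply/seteqP; split=> //.
- exact: subset_trans sub1 sub2.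
- exact: subset_trans sub3 sub1.
Qed.

End Sandwich.
End RealDiagonal.

(** * Projections and the operator system of a graph *)

Section Projections.
Variables (R : realType) (d : nat).
Local Notation C := R[i].
Implicit Types (A P : 'M[C]_d).

Lemma mulmx_adj m n p (A : 'M[C]_(m, n)) (B : 'M[C]_(n, p)) :
  (A *m B)^t* = B^t* *m A^t*.
Proof. by rewrite trmx_mul map_mxM. Qed.

Lemma ketbra_adj (u v : 'cV[C]_d) : (ketbra u v)^t* = ketbra v u.
Proof.
rewrite /ketbra mulmx_adj; congr (_ *m _).
by apply/matrixP => i j; rewrite !mxE conjCK.
Qed.

Lemma ketbra_basis (x y : 'I_d) :
  ketbra (basis_vec R x) (basis_vec R y) = delta_mx x y.
Proof. by rewrite /ketbra basis_vec_adj mul_delta_mx. Qed.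

Lemma mem_graph_opsys (adj : rel 'I_d) A :
  A \in graph_opsys R adj <->
  forall x y, A x y != 0 -> (x == y) || adj x y.
Proof.
rewrite /graph_opsys; set s := image_mem _ _; split=> [As x y|sA].
  rewrite (@coord_span _ _ _ (in_tuple s) _ As) summxE; apply: contraNT => xy.
  apply/eqP/big1 => i _; have /mapP[[a b]] : s`_i \in s by rewrite mem_nth.
  rewrite mem_enum inE /= => ab ->; rewrite ketbra_basis !mxE.
  case: andP => [[/eqP xa /eqP yb]|_]; last by rewrite mulr0.
  by move: ab; rewrite -xa -yb (negbTE xy).
rewrite (matrix_sum_delta A); apply: memv_suml => x _; apply: memv_suml => y _.
have [->|/sA xy] := eqVneq (A x y) 0; first by rewrite scale0r mem0v.
apply/memvZ/memv_span/mapP; exists (x, y); last by rewrite ketbra_basis.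
by rewrite mem_enum inE.
Qed.

Lemma delta_graph_opsys (adj : rel 'I_d) x y :
  (x == y) || adj x y -> delta_mx x y \in graph_opsys R adj.
Proof.
move=> xy; apply/mem_graph_opsys => a b; rewrite mxE.
by case: andP => [[/eqP -> /eqP ->]|]; rewrite ?eqxx.
Qed.

Lemma compression_delta P (a b x y : 'I_d) :
  (P *m delta_mx a b *m P) x y = P x a * P b y.
Proof.
rewrite -(mul_delta_mx (0 : 'I_1)) mulmxA -mulmxA -rowE -colE !mxE big_ord1.
by rewrite !mxE.
Qed.

(** Comparing these entries turns the commutation of two compressed matrix units
    into identities between entries of [P]. *)
Lemma compression_delta2 P (a b c e x y : 'I_d) : P *m P = P ->
  (P *m delta_mx a b *m P *m (P *m delta_mx c e *m P)) x y
  = P x a * P b c * P e y.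
Proof.
move=> PP; rewrite mxE.
under eq_bigr do rewrite !compression_delta -mulrA (mulrA (P b _)).
have PbcE : P b c = \sum_k P b k * P k c by rewrite -[in LHS]PP mxE.
by rewrite -mulr_sumr -mulr_suml mulrA -PbcE.
Qed.

Lemma projection_conj P (x y : 'I_d) : projection P -> P y x = (P x y)^*%R.
Proof. by case=> _ {1}<-; rewrite !mxE. Qed.

(** Both sides are the squared norm of the column [P e_x]. *)
Lemma projection_row P (x : 'I_d) : projection P -> \sum_y `|P x y| ^+ 2 = P x x.
Proof.
move=> pP; rewrite -[in RHS](pP.1) mxE; apply: eq_bigr => y _.
by rewrite normCK (projection_conj x y pP).
Qed.

Lemma projection_diag_ge0 P (x : 'I_d) : projection P -> 0 <= P x x.
Proof. by move=> /projection_row <-; apply: sumr_ge0 => y _; rewrite exprn_ge0. Qed.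

Lemma projection_diagE P (x : 'I_d) : projection P -> (rdiag P 0 x)%:C = P x x.
Proof. by move=> pP; rewrite mxE RRe_real// ger0_real// projection_diag_ge0. Qed.

Lemma projection_rdiag_ge0 P (x : 'I_d) : projection P -> 0 <= rdiag P 0 x.
Proof.
by move=> pP; rewrite -ler0c [X in _ <= X]projection_diagE// projection_diag_ge0.
Qed.

Lemma projection_rdiag_eq0 P (x : 'I_d) :
  projection P -> (rdiag P 0 x == 0) = (P x x == 0).
Proof. by move=> pP; rewrite -(projection_diagE x pP) fmorph_eq0. Qed.

Lemma projection_diag_le1 P (x : 'I_d) : projection P -> P x x <= 1.
Proof.
move=> pP; have P0 := projection_diag_ge0 x pP.
have : P x x ^+ 2 <= P x x.
  rewrite -[in leRHS](projection_row x pP) (bigD1 x)//= ger0_norm// lerDl.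
  by apply: sumr_ge0 => y _; rewrite exprn_ge0.
have [->|PN0] := eqVneq (P x x) 0; first by rewrite ler01.
by rewrite expr2 ger_pMr// lt_neqAle eq_sym PN0.
Qed.

Lemma mem_ran P (v : 'cV[C]_d) : P *m P = P -> (v \in ran P) = (P *m v == v).
Proof.
move=> PP; apply/idP/eqP => [/memv_imgP[u _ ->]|<-].
  by rewrite lfunE /= mulmxA PP.
by have := memv_img (linfun (mulmx P : 'cV[C]_d -> _)) (memvf v); rewrite lfunE.
Qed.

Lemma projection_char_vec (S : {set 'I_d}) :
  projection (diag_of_real (char_vec R S)).
Proof.
split; rewrite /diag_of_real.
  rewrite mulmx_diag; congr diag_mx; apply/rowP => x; rewrite !mxE.
  by case: (x \in S); rewrite ?rmorph1 ?rmorph0 ?mulr1 ?mulr0.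
apply/matrixP => x y; rewrite !mxE eq_sym; have [->|] := eqVneq x y.
  by rewrite !mulr1n; case: (y \in S); rewrite ?rmorph1 ?rmorph0.
by rewrite !mulr0n rmorph0.
Qed.

Lemma char_vec_mul (S : {set 'I_d}) n (A : 'M[C]_(d, n)) x y :
  (diag_of_real (char_vec R S) *m A) x y = (x \in S)%:R * A x y.
Proof. by rewrite /diag_of_real mul_diag_mx !mxE rmorph_nat. Qed.

Lemma mul_char_vec (S : {set 'I_d}) n (A : 'M[C]_(n, d)) x y :
  (A *m diag_of_real (char_vec R S)) x y = A x y * (y \in S)%:R.
Proof. by rewrite /diag_of_real mul_mx_diag !mxE rmorph_nat. Qed.

End Projections.

(** * Abelian projections and independent sets *)

Section Abelian.
Variables (R : realType) (d : nat) (adj : rel 'I_d).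
Local Notation C := R[i].
Implicit Types (A P : 'M[C]_d).
Local Notation SG := (graph_opsys R adj).

(** Put [u_x = P e_x], so that [P x y] is the inner product of [u_y] and [u_x].
    The rank one operators [u_x u_x^*] belong to a commutative algebra, hence
    the [u_x] are pairwise orthogonal or parallel, and being non-orthogonal is
    an equivalence relation on the nonzero ones. If [x] and [y] are adjacent then
    [u_x u_y^*] lies in the same algebra and commutes with [u_x u_x^*], which
    forbids [u_x] and [u_y] to be orthogonal unless one of them is zero. So
    adjacent vertices of the support share a class. In a class the vectors are
    parallel, so Cauchy-Schwarz is an equality there and [projection_row], read at
    one member, bounds the mass of the class by 1. *)
Lemma rdiag_abelian P : abelian_proj SG P -> vp R adj (rdiag P).
Proof.
move=> [pP [A [_ cA SA]]].
have PP := pP.1.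
have comm a b c e x y : (a == b) || adj a b -> (c == e) || adj c e ->
    P x a * P b c * P e y = P x c * P e a * P b y.
  move=> /delta_graph_opsys/SA Aab /delta_graph_opsys/SA Ace.
  have /matrixP/(_ x y) := cA _ _ Aab Ace.
  by rewrite [LHS](compression_delta2 _ _ _ _ _ _ PP)
    [RHS](compression_delta2 _ _ _ _ _ _ PP).
have Pconj0 x y : (P y x == 0) = (P x y == 0).
  by rewrite (projection_conj x y pP) fmorph_eq0.
(* equality in Cauchy-Schwarz for u_a and u_b *)
have parallel a b : P a b != 0 -> `|P a b| ^+ 2 = P a a * P b b.
  move=> ab; apply: (mulIf ab); rewrite normCK -(projection_conj a b pP).
  by have := comm a a b b a b; rewrite !eqxx => /(_ isT isT) <-; rewrite mulrAC.
(* the commutator of the compressions at b and c, at entry (a, b) *)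
have trans a b c : P a b != 0 -> P b c != 0 -> P a c != 0.
  move=> ab bc; have := comm b b c c a b; rewrite !eqxx => /(_ isT isT) E.
  have : P a b * P b c * P c b != 0 by rewrite !mulf_neq0// Pconj0.
  by rewrite E; apply: contraNneq => ->; rewrite !mul0r.
pose cls x := [set y | P x y != 0]%SET.
apply: (@vp_classes _ _ _ _ cls).
- by move=> x; exact: projection_rdiag_ge0.
- move=> c; have [/existsP[x0 /andP[/eqP <- x0N0]]|/existsPn noc] :=
    boolP [exists x, (cls x == c) && (P x x != 0)]; last first.
    rewrite big1 ?ler01// => x xc; apply/eqP; rewrite projection_rdiag_eq0//.
    by have := noc x; rewrite xc negbK.
  have px0 : 0 < P x0 x0 by rewrite lt_neqAle eq_sym x0N0 projection_diag_ge0.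
  rewrite -lecR rmorph_sum rmorph1 -(ler_pM2l px0) mulr1 mulr_sumr.
  rewrite -[leRHS](projection_row x0 pP) [leLHS]big_mkcond; apply: ler_sum => x _.
  case: ifP => [/eqP xx0|_]; last by rewrite exprn_ge0.
  rewrite [X in _ * X](projection_diagE x pP); have [->|xN0] := eqVneq (P x x) 0.
    by rewrite mulr0 exprn_ge0.
  have : x \in cls x0 by rewrite -xx0 inE.
  by rewrite inE => /parallel <-.
- move=> x y xy axy; rewrite !projection_rdiag_eq0// => xN0 yN0.
  have Pxy : P x y != 0.
    have := comm x x x y x y; rewrite eqxx axy orbT => /(_ isT isT) E.
    have : P x x * P x x * P y y != 0 by rewrite !mulf_neq0.
    by rewrite E; apply: contraNneq => ->; rewrite mulr0.
  apply/setP => z; rewrite !inE; apply/idP/idP; last exact: trans.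
  by apply: trans; rewrite Pconj0.
Qed.

(** For independent [S], compression by the coordinate projection of [S] kills
    every off-diagonal entry that the operator system allows, so the diagonal
    matrices serve as the commutative algebra. *)
Lemma abelian_char_vec (S : {set 'I_d}) :
  independent adj S -> abelian_proj SG (diag_of_real (char_vec R S)).
Proof.
move=> indS; split; first exact: projection_char_vec.
exists (diagonals R d); split.
- split.
  + exact: mx0_is_diag.
  + move=> a A B /is_diag_mxP dA /is_diag_mxP dB; apply/is_diag_mxP => x y xy.
    by rewrite !mxE dA// dB// mulr0 addr0.
  + move=> A B /diag_mxP[a ->] /diag_mxP[b ->].
    rewrite mulmx_diag; exact: diag_mx_is_diag.
  + move=> A /is_diag_mxP dA; apply/is_diag_mxP => x y xy.
    by rewrite !mxE dA ?rmorph0// eq_sym.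
  + have -> : diagonals R d = \bigcap_(p in [set p : 'I_d * 'I_d | p.1 != p.2])
        (fun A : 'M[C]_d => A p.1 p.2) @^-1` [set 0].
      apply/seteqP; split=> A /=.
        by move=> /is_diag_mxP dA [x y] /= xy; exact: dA.
      by move=> dA; apply/is_diag_mxP => x y xy; exact: (dA (x, y)).
    apply: closed_bigI => -[x y] /= xy; apply: preimage_closed => [A _|].
      exact: coord_continuous.
    apply: accessible_closed_set1; apply: hausdorff_accessible.
    exact: (@norm_hausdorff C C^o).
- move=> A B /diag_mxP[a ->] /diag_mxP[b ->]; rewrite !mulmx_diag.
  by congr diag_mx; apply/rowP => x; rewrite !mxE mulrC.
- move=> T /mem_graph_opsys ST; apply/is_diag_mxP => x y xyN.
  have xy : x != y := xyN.
  rewrite mul_char_vec char_vec_mul.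
  case: (boolP (x \in S)) => xS; rewrite ?mul0r//.
  case: (boolP (y \in S)) => yS; rewrite ?mulr0// mulr1 mul1r.
  apply/eqP/negPn/negP => /ST; rewrite (negbTE xy) /=; apply/negP; exact: indS.
Qed.

End Abelian.

(** * Clique and full projections *)

Section CliqueFull.
Variables (R : realType) (d : nat) (adj : rel 'I_d).
Local Notation C := R[i].
Implicit Types (A P : 'M[C]_d).
Local Notation SG := (graph_opsys R adj).

(** Two self-adjoint idempotents with the same range are equal. *)
Lemma clique_projE P m (xi : 'I_m -> 'cV[C]_d) : projection P ->
  (forall i j, inner (xi i) (xi j) = (i == j)%:R) -> ran P = <<codom xi>>%VS ->
  P = \sum_i ketbra (xi i) (xi i).
Proof.
move=> pP on ranP; set Q := \sum_i _.
have Pxi i : P *m xi i = xi i.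
  apply/eqP; rewrite -mem_ran; last exact: pP.1.
  by rewrite ranP memv_span// codom_f.
have PQ : P *m Q = Q.
  by rewrite mulmx_sumr; apply: eq_bigr => i _; rewrite /ketbra mulmxA Pxi.
have Qxi i : Q *m xi i = xi i.
  rewrite mulmx_suml (bigD1 i)//= big1 ?addr0 => [|j ji];
    rewrite /ketbra -mulmxA [_ *m xi i]mx11_scalar -/(inner _ _) on mul_mx_scalar.
    by rewrite eqxx scale1r.
  by rewrite eq_sym (negbTE ji) scale0r.
have QP : Q *m P = P.
  have Qv v : v \in ran P -> Q *m v = v.
    rewrite ranP => /(@coord_span _ _ _ (in_tuple (codom xi))) ->.
    rewrite mulmx_sumr; apply: eq_bigr => i _; rewrite -scalemxAr; congr (_ *: _).
    have /codomP[j ->] : (codom xi)`_i \in codom xi by rewrite mem_nth.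
    exact: Qxi.
  apply/matrixP => x y; have colP : col y P \in ran P.
    by rewrite mem_ran ?pP.1// colE mulmxA pP.1.
  have := congr1 (fun v : 'cV_d => v x 0) (Qv _ colP).
  by rewrite colE mulmxA -!colE [LHS]mxE [RHS]mxE.
have Qadj : Q^t* = Q.
  rewrite /Q linear_sum raddf_sum; apply: eq_bigr => i _; exact: ketbra_adj.
by rewrite -[RHS]Qadj -PQ mulmx_adj Qadj pP.2 QP.
Qed.

Lemma graph_complP x y :
  graph_compl adj x y -> ~~ ((x == y) || adj x y).
Proof. by rewrite negb_or. Qed.

(** If [x] and [y] are distinct and non-adjacent, with [xi i] nonzero at [x] and
    [xi j] nonzero at [y], then [i = j], since otherwise [xi i (xi j)^*] would have
    a forbidden entry. Thus both vertices lie in the support of the same single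
    member of the clique. The classes are therefore, for each [i], the vertices
    supporting [xi i] only, of mass at most [|xi i|^2 = 1], and the remaining
    vertices one by one, of mass [P x x <= 1]. *)
Lemma rdiag_clique P : clique_proj SG P -> vp R (graph_compl adj) (rdiag P).
Proof.
move=> [pP [m [xi [[on SGxi] ranP]]]].
have PE := clique_projE pP on ranP.
have diagE x : P x x = \sum_i `|xi i x 0| ^+ 2.
  by rewrite PE summxE; apply: eq_bigr => i _; rewrite normCK !mxE big_ord1 !mxE.
have norm1 i : \sum_x `|xi i x 0| ^+ 2 = 1.
  rewrite (_ : 1 = inner (xi i) (xi i)); last by rewrite on eqxx.
  by rewrite /inner mxE; apply: eq_bigr => x _; rewrite !mxE mulrC normCK.
have xi_compl i j x y : graph_compl adj x y -> xi i x 0 != 0 -> xi j y 0 != 0 ->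
    i = j.
  move=> /graph_complP xy xix xjy; apply/eqP; apply: contraNT xy => ij.
  have /mem_graph_opsys := SGxi i j ij; apply.
  by rewrite !mxE big_ord1 !mxE mulf_neq0// fmorph_eq0.
have supp x : rdiag P 0 x != 0 -> exists i, xi i x 0 != 0.
  rewrite projection_rdiag_eq0//.
  apply: contraNP => /forallNP xi0; rewrite diagE big1// => i _.
  by have /negP := xi0 i; rewrite negbK => /eqP ->; rewrite normr0 expr0n.
pose only x i := (xi i x 0 != 0) && [forall j, (xi j x 0 != 0) ==> (j == i)].
have only_uniq x i j : only x i -> only x j -> i = j.
  by move=> /andP[xi0 _] /andP[_ /forallP/(_ i)]; rewrite xi0 => /eqP.
pose cls x : 'I_m + 'I_d := if [pick i | only x i] is Some i then inl i else inr x.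
have clsE x i : only x i -> cls x = inl i.
  rewrite /cls; case: pickP => [j oj oi|/(_ i) ->//].
  by rewrite (only_uniq _ _ _ oj oi).
apply: (@vp_classes _ _ _ _ cls).
- by move=> x; exact: projection_rdiag_ge0.
- move=> [i|z]; rewrite -lecR rmorph_sum rmorph1.
    rewrite -[leRHS](norm1 i) [leLHS]big_mkcond; apply: ler_sum => x _.
    case: ifP => [|_]; last by rewrite exprn_ge0.
    rewrite /cls; case: pickP => // j /andP[_ /forallP oj] /eqP[ji].
    rewrite [X in X <= _](projection_diagE x pP) diagE (bigD1 i)//= big1 ?addr0//.
    move=> k ki; have := oj k; rewrite ji (negbTE ki) implybF negbK => /eqP ->.
    by rewrite normr0 expr0n.
  apply: le_trans (projection_diag_le1 z pP); rewrite -(projection_diagE z pP).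
  rewrite big_mkcond (bigD1 z)//= big1 ?addr0 => [|x xz].
    by case: ifP => // _; rewrite [leRHS](projection_diagE z pP) projection_diag_ge0.
  case: ifP => //; rewrite /cls; case: pickP => // _ /eqP[xz'].
  by rewrite xz' eqxx in xz.
- move=> x y xy cxy /supp[i xix] /supp[j xjy].
  have ij := xi_compl i j x y cxy xix xjy; rewrite -{}ij in xjy.
  have onlyx : only x i.
    rewrite /only xix; apply/forallP => k; apply/implyP => xkx.
    by apply/eqP; exact: (xi_compl k i x y).
  have onlyy : only y i.
    rewrite /only xjy; apply/forallP => k; apply/implyP => xky.
    by apply/eqP/esym; exact: (xi_compl i k x y).
  by rewrite (clsE _ _ onlyx) (clsE _ _ onlyy).
Qed.

(** Every [P T P] lies in the operator system; for a matrix unit [T] at [(x, y)]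
    its entry there is [P x x * P y y], so the support of the diagonal is a
    clique of the graph, and one-vertex classes suffice. *)
Lemma rdiag_full P : full_proj SG P -> vp R (graph_compl adj) (rdiag P).
Proof.
move=> [pP fullP].
have SGP T : P *m T *m P \in SG.
  apply: fullP; split=> v vP.
    by rewrite mem_ran ?pP.1// !mulmxA pP.1.
  suff -> : P *m T *m P *m v = P *m T *m (P *m v).
    suff -> : P *m v = 0 by rewrite mulmx0.
    apply/colP => x; rewrite [RHS]mxE.
    have <- : inner v (P *m basis_vec R x) = (P *m v) x 0.
      by rewrite /inner mulmx_adj pP.2 basis_vec_adj -mulmxA -rowE mxE.
    by apply: vP; rewrite mem_ran ?pP.1// mulmxA pP.1.
  by rewrite !mulmxA.
have suppP x y : P x x != 0 -> P y y != 0 -> (x == y) || adj x y.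
  move=> x0 y0; have /mem_graph_opsys := SGP (delta_mx x y); apply.
  by rewrite compression_delta mulf_neq0.
apply: (@vp_classes _ _ _ _ id).
- by move=> x; exact: projection_rdiag_ge0.
- move=> x; rewrite big_pred1_eq -lecR projection_diagE//.
  exact: projection_diag_le1.
- move=> x y xy /graph_complP; rewrite !projection_rdiag_eq0// => nxy x0 y0.
  by rewrite suppP in nxy.
Qed.

Section Indicator.
Variable S : {set 'I_d}.
Hypothesis cliqueS : independent (graph_compl adj) S.
Local Notation Q := (diag_of_real (char_vec R S)).

Lemma clique_adj x y : x \in S -> y \in S -> (x == y) || adj x y.
Proof.
move=> xS yS; have [//|xy] := eqVneq x y.
by have := cliqueS xS yS xy; rewrite /graph_compl /= xy negbK.
Qed.

Lemma mem_ran_char_vec (v : 'cV[C]_d) :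
  (v \in ran Q) = [forall x, (x \in S) || (v x 0 == 0)].
Proof.
rewrite mem_ran; last exact: (projection_char_vec R S).1.
apply/eqP/forallP => [<- x|vS].
  by rewrite char_vec_mul; case: (x \in S); rewrite // mul0r eqxx.
apply/colP => x; rewrite char_vec_mul.
by have := vS x; case: (x \in S) => [_|/= /eqP ->]; rewrite ?mul1r// mulr0.
Qed.

Lemma basis_vec_ran x : x \in S -> basis_vec R x \in ran Q.
Proof.
move=> xS; rewrite mem_ran_char_vec; apply/forallP => y; rewrite mxE.
by have [->|_] := eqVneq y x; rewrite ?xS// mulr0n eqxx orbT.
Qed.

Lemma clique_char_vec : clique_proj SG Q.
Proof.
split; first exact: projection_char_vec.
exists #|S|, (fun i => basis_vec R (enum_val i)); split; first split.
- move=> i j; rewrite /inner basis_vec_adj mul_delta_mx_cond (inj_eq enum_val_inj).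
  by rewrite eq_sym; case: (_ == _); rewrite ?mulr1n ?mulr0n mxE.
- move=> i j ij; rewrite ketbra_basis; apply: delta_graph_opsys.
  exact: clique_adj (enum_valP _) (enum_valP _).
- apply/eqP; rewrite eqEsubv; apply/andP; split; last first.
    by apply/span_subvP => _ /codomP[i ->]; exact/basis_vec_ran/enum_valP.
  apply/subvP => v; rewrite mem_ran_char_vec => /forallP vS.
  rewrite (matrix_sum_delta v); apply: memv_suml => x _; rewrite big_ord1.
  have := vS x; case: (boolP (x \in S)) => [xS _|_ /= /eqP ->].
    apply/memvZ/memv_span/codomP; exists (enum_rank_in xS x).
    by rewrite enum_rankK_in.
  by rewrite scale0r mem0v.
Qed.

(** A matrix in the corner of the coordinate projection of [S] has all its
    entries in [S * S], and these positions are all allowed when [S] is a clique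
    of the graph. *)
Lemma full_char_vec : full_proj SG Q.
Proof.
split; first exact: projection_char_vec.
move=> A [Aran Akill]; apply/mem_graph_opsys => x y Axy.
have colA : (A *m basis_vec R y) x 0 = A x y by rewrite -colE mxE.
have yS : y \in S.
  apply: contraNT Axy => yS; rewrite -colA Akill ?mxE// => w.
  rewrite mem_ran_char_vec => /forallP/(_ y); rewrite (negbTE yS) /= => /eqP wy.
  by rewrite /inner -colE !mxE wy rmorph0.
apply: clique_adj => //; apply: contraNT Axy => xS; rewrite -colA.
have := Aran _ (basis_vec_ran yS).
by rewrite mem_ran_char_vec => /forallP/(_ x); rewrite (negbTE xS).
Qed.

End Indicator.
End CliqueFull.

Theorem theorem3p5 (R : realType) (d : nat) (adj : rel 'I_d)
    (adj_sym : symmetric adj) (adj_irr : irreflexive adj) :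
  [/\ @Delta R d @` ap (graph_opsys R adj)
        = diagonals R d `&` ap (graph_opsys R adj)
      /\ diagonals R d `&` ap (graph_opsys R adj)
        = @diag_of_real R d @` vp R adj,
      @Delta R d @` cp (graph_opsys R adj)
        = diagonals R d `&` cp (graph_opsys R adj)
      /\ diagonals R d `&` cp (graph_opsys R adj)
        = @diag_of_real R d @` vp R (graph_compl adj)
    & @Delta R d @` fp (graph_opsys R adj)
        = diagonals R d `&` fp (graph_opsys R adj)
      /\ diagonals R d `&` fp (graph_opsys R adj)
        = @diag_of_real R d @` vp R (graph_compl adj)].
Proof.
split; apply: diagonal_corners.
- exact: rdiag_abelian.
- exact: abelian_char_vec.
- exact: rdiag_clique.
- exact: clique_char_vec.
- exact: rdiag_full.
- exact: full_char_vec.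
Qed.
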